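(* Let $n\ge 2$ and let $\mathbf v_1,\dots,\mathbf v_{n+1}\in\mathbb R^n$ be affinely independent. Put $$\ell_{ij}:=|\mathbf v_i-\mathbf v_j|,\qquad \delta:=|\det(\mathbf v_2-\mathbf v_1,\dots,\mathbf v_{n+1}-\mathbf v_1)|.$$ For nonnegative edge weights $\rho=(\rho_e)_{e\in E}$ with $\tau(\rho)>0$, $$\sum_{e\in E}\rho_e\ell_e\ \ge\ c_n\,\bigl(\delta\,\tau(\rho)\bigr)^{1/n}.$$ Equality holds if and only if the simplex with vertices $\mathbf v_1,\dots,\mathbf v_{n+1}$ is regular and all the edge weights $\rho_e$ are equal.
   Context: $E=\binom{[n+1]}{2}$ is the edge set of the complete graph $K_{n+1}$ on the vertex set $[n+1]=\{1,\dots,n+1\}$; an edge $\{i,j\}$ is written $ij$. The spanning-tree polynomial is $\tau(\rho)=\sum_{J}\prod_{e\in J}\rho_e$, the sum running over the edge sets $J$ of all spanning trees of $K_{n+1}$. The constant is $c_n=\frac{n}{\sqrt2}(n+1)^{1/(2n)}$. $|\cdot|$ is the Euclidean norm on vectors and absolute value on scalars. *)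

(* Defs.v *)
From mathcomp Require Import all_boot all_order all_algebra.
From mathcomp Require Import boolp reals exp.

Set Implicit Arguments.
Unset Strict Implicit.
Unset Printing Implicit Defensive.

Import Order.TTheory GRing.Theory Num.Theory.

Local Open Scope ring_scope.

(* Vertex i of the mathematical set {1, ..., n+1} is the ordinal i - 1. *)
Section CompleteGraph.
Variable n : nat.
Implicit Types J : {set {set 'I_n.+1}}.

Definition edges : {set {set 'I_n.+1}} := [set e : {set 'I_n.+1} | #|e| == 2%N]%SET.

Definition adj J : rel 'I_n.+1 := [rel i j | [set i; j]%SET \in J].

Definition is_spanning_tree J : Prop :=
  [/\ J \subset edges,
      forall i j, connect (adj J) i j
    & forall c : seq 'I_n.+1, (2 < size c)%N -> uniq c -> ~~ cycle (adj J) c].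

Definition spanning_tree_poly (R : realType) (rho : {set 'I_n.+1} -> R) : R :=
  \sum_(J : {set {set 'I_n.+1}} | `[< is_spanning_tree J >])
    \prod_(e in J) rho e.

End CompleteGraph.

Section Simplex.
Variables (R : realType) (n : nat).
Implicit Types v : 'I_n.+1 -> 'cV[R]_n.

(* The library norm `|_| on matrices is the sup norm, hence this definition. *)
Definition enorm (x : 'cV[R]_n) : R := Num.sqrt (\sum_i x i 0 ^+ 2).

Definition affinely_independent v : Prop :=
  forall a : 'I_n.+1 -> R,
    \sum_i a i = 0 -> \sum_i a i *: v i = 0 -> forall i, a i = 0.

Definition edge_length v (i j : 'I_n.+1) : R := enorm (v i - v j).

Definition edge_absdet v : R :=
  `| \det (\matrix_(i < n, j < n) (v (lift ord0 j) - v ord0) i 0) |.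

Definition regular_simplex v : Prop :=
  forall i j k l : 'I_n.+1, i != j -> k != l ->
    edge_length v i j = edge_length v k l.

(* Each edge e = {i, j} occurs exactly once, as the pair with i < j. *)
Definition weighted_length v (rho : {set 'I_n.+1} -> R) : R :=
  \sum_(i < n.+1) \sum_(j < n.+1 | (i < j)%N)
    rho [set i; j]%SET * edge_length v i j.

End Simplex.

Definition tree_cst (R : realType) (n : nat) : R :=
  n%:R / Num.sqrt 2 * n.+1%:R `^ ((2 * n)%:R)^-1.

(* Main.v *)
Require Import Defs.
From mathcomp Require Import all_boot all_order all_algebra.
From mathcomp Require Import boolp reals exp.
From mathcomp Require Import perm ring.

Set Implicit Arguments.
Unset Strict Implicit.
Unset Printing Implicit Defensive.

Import Order.TTheory GRing.Theory Num.Theory.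

Local Open Scope ring_scope.

(** Write [l e] for the length of the edge [e], [tau] for the spanning-tree
    polynomial and [S] for the sum of the [rho e * l e]. The idea is to split
    the weight as a geometric mean, [rho ^ 2 = (rho / l) * (rho * l)], and to
    bound [tau] of the two factors by the same [S]:

      [tau rho ^ 2 <= tau (rho / l) * tau (rho * l)]

    by Cauchy-Schwarz over the spanning trees. By the weighted matrix-tree
    theorem, if [L w] is the Laplacian reduced at a root and [M] is the matrix
    of the edge vectors at that root, then [M (L w) M^T] has determinant
    [det M ^ 2 * tau w] and trace the sum of the [w e * l e ^ 2]; as it is
    positive semidefinite, its determinant is at most the [n]-th power of its
    trace divided by [n]. With [w = rho / l] and the given simplex this is

      [delta ^ 2 * tau (rho / l) <= (S / n) ^ n].

    With [w = rho * l] and a regular simplex of edge length [sqrt 2], for which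
    [det M ^ 2 = n + 1], it is

      [(n + 1) * tau (rho * l) <= (2 * S / n) ^ n].

    Multiplying the three inequalities gives the [2n]-th power of the claim.

    In the equality case the last inequality is an equality, so the second
    matrix is scalar, and this forces all [rho e * l e] to be equal; and the
    Cauchy-Schwarz inequality is an equality, so that the product of the lengths
    along a spanning tree does not depend on the tree, which forces all [l e] to
    be equal. For a regular simplex with equal weights both sides are computed
    from the same determinants.

    The matrix-tree theorem is proved by expanding the determinant along its
    rows into a sum over maps [f] from non-root vertices to vertices
    ([det_laplacian]). The map [f] contributes the determinant of [1 - P], with
    [P] the matrix of [f], which is [1] if iterating [f] always leads to the root
    and [0] otherwise ([det_parent]). The maps that lead to the root are the
    parent maps of the spanning trees ([spanning_tree_polyE]). The bound of a
    determinant by the trace is Hadamard's inequality followed by the inequality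
    of means on the diagonal ([det_le_trace]). *)

(** * Spanning trees as parent maps *)

Section ParentMaps.
Variable n : nat.
Implicit Types (f g : {ffun 'I_n -> 'I_n.+1}) (J : {set {set 'I_n.+1}}).

(** The root [ord0] is made a fixed point, so that reaching it under iteration
    makes sense. *)
Definition parent f (i : 'I_n.+1) : 'I_n.+1 :=
  if unlift ord0 i is Some k then f k else ord0.

Definition rooted f := [forall i, fconnect (parent f) i ord0].

Lemma parent_lift f k : parent f (lift ord0 k) = f k.
Proof. by rewrite /parent liftK. Qed.

Lemma ord0_lift_case (i : 'I_n.+1) : i = ord0 \/ exists k, i = lift ord0 k.
Proof. by case: (unliftP ord0 i) => [k ->|->]; [right; exists k | left]. Qed.

(** All later arguments on rooted maps are inductions on such a height [d], which
    need not be the distance to the root. *)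
Lemma rootedP f :
  reflect (exists d : 'I_n.+1 -> nat,
             forall k, (d (f k) < d (lift ord0 k))%N) (rooted f).
Proof.
apply: (iffP forallP) => [fr | [d dlt] i].
  have ex i : exists k, iter k (parent f) i == ord0.
    by exists (findex (parent f) i ord0); rewrite iter_findex.
  exists (fun i => ex_minn (ex i)) => k.
  case: (ex_minnP (ex (lift ord0 k))) => [[|m]] // /eqP.
  rewrite iterSr parent_lift => mE _.
  case: ex_minnP => m' _ m'_min; rewrite ltnS m'_min //; exact/eqP.
have [m] := ubnP (d i); elim: m i => // m IH i lem.
have [->|[k iE]] := ord0_lift_case i; first exact: connect0.
apply: (connect_trans (fconnect1 _ _)); apply: IH.
by rewrite iE parent_lift (leq_trans (dlt k)) // -iE -ltnS.
Qed.

Lemma rooted_neq f k : rooted f -> f k != lift ord0 k.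
Proof.
by move=> /rootedP[d /(_ k)]; apply: contraTneq => ->; rewrite ltnn.
Qed.

Lemma rooted_no_swap f a b :
  rooted f -> f a = lift ord0 b -> f b = lift ord0 a -> False.
Proof.
move=> /rootedP[d dlt] fa fb; have := dlt a; have := dlt b.
by rewrite fa fb => /ltnW; rewrite leqNgt => /negP.
Qed.

Definition parent_edge f (k : 'I_n) : {set 'I_n.+1} := [set lift ord0 k; f k]%SET.

Definition parent_tree f : {set {set 'I_n.+1}} :=
  [set parent_edge f k | k in 'I_n]%SET.

Lemma set2_eqP (T : finType) (a b c e : T) :
  ([set a; b] = [set c; e])%SET -> (a = c /\ b = e) \/ (a = e /\ b = c).
Proof.
move=> E.
have := set21 a b; have := set22 a b; have := set21 c e; have := set22 c e.
rewrite E -{1 2}E !in_set2.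
by do 4!case/orP => /eqP ?; subst; auto.
Qed.

Lemma parent_edge_inj f : rooted f -> injective (parent_edge f).
Proof.
move=> fr a b /set2_eqP[[/lift_inj->]//|[fb fa]].
by case: (rooted_no_swap fr fa).
Qed.

Lemma parent_tree_adj f k : adj (parent_tree f) (lift ord0 k) (f k).
Proof. exact: imset_f. Qed.

Lemma adj_sym J : symmetric (adj J).
Proof. by move=> i j; rewrite /adj /= setUC. Qed.

Lemma parent_tree_connect0 f i : rooted f -> connect (adj (parent_tree f)) i ord0.
Proof.
move=> /rootedP[d dlt].
have [m] := ubnP (d i); elim: m i => // m IH i lem.
have [->|[k iE]] := ord0_lift_case i; first exact: connect0.
rewrite iE; apply: (connect_trans (connect1 (parent_tree_adj f k))); apply: IH.
by rewrite (leq_trans (dlt k)) // -iE -ltnS.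
Qed.

Lemma parent_tree_connect f i j :
  rooted f -> connect (adj (parent_tree f)) i j.
Proof.
move=> fr; apply: connect_trans (parent_tree_connect0 i fr) _.
rewrite (sym_connect_sym (@adj_sym _)); exact: parent_tree_connect0.
Qed.

(** A vertex of maximal height on a cycle would have both its neighbours there as
    its parent. *)
Lemma parent_tree_acyclic f (c : seq 'I_n.+1) :
  rooted f -> (2 < size c)%N -> uniq c -> ~~ cycle (adj (parent_tree f)) c.
Proof.
move=> /rootedP[d dlt] c_gt2 c_uniq; apply/negP => c_cycle.
have [x0 x0c] : exists x, x \in c.
  by case: c c_gt2 {c_uniq c_cycle} => // x c _; exists x; rewrite mem_head.
case: (@arg_maxnP _ x0 [in c] d x0c) => x xc dmax.
have toparent y : y \in c -> adj (parent_tree f) x y -> y = parent f x.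
  move=> yc /imsetP[k _] /set2_eqP[[-> ->]|[xE yE]]; first by rewrite parent_lift.
  by have /= := dmax y yc; rewrite xE yE /geq /= leqNgt dlt.
have [i c' cE] := rot_to xc.
have c'c y : y \in c' -> y \in c by move=> yc'; rewrite -(mem_rot i) cE inE yc' orbT.
move: c_cycle c_uniq c_gt2; rewrite -(rot_cycle i) -(rot_uniq i) -(size_rot i) cE.
case: c' c'c {cE} => [|y q] // c'c /=; case/lastP: q c'c => [|q z] // c'c.
rewrite rcons_path last_rcons => /andP[xy /andP[_ zx]] /and3P[_ yq _] _.
rewrite adj_sym in zx; move: yq.
have yc' : y \in y :: rcons q z by apply: mem_head.
have zc' : z \in y :: rcons q z by rewrite inE mem_rcons mem_head orbT.
by rewrite (toparent y (c'c _ yc') xy) (toparent z (c'c _ zc') zx) mem_rcons mem_head.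
Qed.

Lemma parent_tree_spanning f : rooted f -> is_spanning_tree (parent_tree f).
Proof.
move=> fr; split.
- apply/subsetP => _ /imsetP[k _ ->]; rewrite inE cards2.
  by have := rooted_neq k fr; rewrite eq_sym => ->.
- by move=> i j; apply: parent_tree_connect.
- by move=> c; apply: parent_tree_acyclic.
Qed.

(** By induction on the height in [f]: the edge from [i] to [f i] belongs to the
    tree of [g], either as the edge above [i] or as the one above [f i]; in the
    latter case [f] would swap [i] and [f i]. *)
Lemma parent_tree_inj f g :
  rooted f -> rooted g -> parent_tree f = parent_tree g -> f = g.
Proof.
move=> fr gr fg; have /rootedP[d dlt] := fr.
suff H i k : i = lift ord0 k -> f k = g k by apply/ffunP => k; apply: H.
have [m] := ubnP (d i); elim: m i k => // m IH i k lem iE.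
have : parent_edge f k \in parent_tree g by rewrite -fg imset_f.
case/imsetP => b _ /set2_eqP[[/lift_inj -> -> //]|[gb fk]].
have fbgb : f b = g b.
  by apply: (IH (f k)) => //; rewrite (leq_trans (dlt k)) // -iE -ltnS.
by case: (rooted_no_swap fr fk); rewrite fbgb.
Qed.

(** Each non-root vertex is sent to a neighbour at smaller distance from the
    root. The resulting tree is already connected, so an acyclic [J] has no
    further edge. *)
Lemma spanning_tree_parent J :
  is_spanning_tree J -> exists2 f, rooted f & parent_tree f = J.
Proof.
case=> Jedges Jconn Jacyc; set e := adj J.
pose reach i k := [exists p : k.-tuple 'I_n.+1, path e i p && (last i p == ord0)].
have ex i : exists k, reach i k.
  have /connectP[p pp plast] := Jconn i ord0; exists (size p).
  by apply/existsP; exists (in_tuple p); rewrite pp -plast eqxx.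
(* [d] is the distance to the root in [J]. *)
pose d i := ex_minn (ex i).
have step k : exists x, e (lift ord0 k) x && (d x < d (lift ord0 k))%N.
  rewrite {2}/d; case: ex_minnP => m /existsP[[p /= /eqP pm]] /andP[pp plast] _.
  case: p pm pp plast => [|x p] //= <- /andP[ex1 pp] plast.
  exists x; rewrite ex1 ltnS /d; case: ex_minnP => m' _; apply.
  by apply/existsP; exists (in_tuple p); rewrite /= pp plast.
pose f := [ffun k => xchoose (step k)].
have fP k : e (lift ord0 k) (f k) /\ (d (f k) < d (lift ord0 k))%N.
  by rewrite ffunE; apply/andP/(xchooseP (step k)).
have fr : rooted f by apply/rootedP; exists d => k; case: (fP k).
have subJ : parent_tree f \subset J.
  by apply/subsetP => _ /imsetP[k _ ->]; case: (fP k).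
exists f => //; apply/eqP; rewrite eqEsubset subJ; apply/subsetP => s sJ.
have := subsetP Jedges s sJ; rewrite inE => /cards2P[i [j [ij sE]]].
apply: contraT => sNf.
(* An edge outside the parent tree would close a cycle with its path there. *)
have /connectP[p pp jE] := parent_tree_connect i j fr.
case/shortenP: pp jE => q qp q_uniq _ jE.
suff /negP[] : ~~ cycle e (i :: q).
  rewrite /= rcons_path -jE /e {2}/adj /= setUC -sE sJ andbT.
  by apply: sub_path qp => a b /=; apply: (subsetP subJ).
apply: Jacyc q_uniq.
case: q qp jE {p} => [|x [|y q]] //=; first by move=> _ ji; rewrite ji eqxx in ij.
by move=> /andP[ix _] jE; move: ix; rewrite -jE /adj /= -sE (negPf sNf).
Qed.

Lemma spanning_tree_polyE (R : realType) (rho : {set 'I_n.+1} -> R) :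
  spanning_tree_poly rho =
  \sum_(f | rooted f) \prod_k rho [set lift ord0 k; f k]%SET.
Proof.
rewrite /spanning_tree_poly.
rewrite (eq_bigl (mem [set parent_tree f | f in rooted]%SET)); last first.
  move=> J; apply/asboolP/imsetP => [/spanning_tree_parent[f fr <-]|[f fr ->]].
    by exists f.
  exact: parent_tree_spanning.
rewrite big_imset; last by move=> f g; apply: parent_tree_inj.
apply: eq_bigr => f fr; rewrite /parent_tree big_imset //.
by move=> a b _ _; apply: parent_edge_inj.
Qed.

(** For a rooted map, only the identity permutation contributes: another one
    would follow [f] on its moved points, which have no lowest element. For a
    map that is not rooted, the indicator of the vertices that never reach the
    root is in the kernel. *)
Lemma det_parent (R : fieldType) f :
  \det (\matrix_(a, b) ((a == b)%:R - (f a == lift ord0 b)%:R)) = (rooted f)%:R :> R.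
Proof.
have [fr|fNr] := boolP (rooted f).
  have /rootedP[d dlt] := fr.
  rewrite /determinant (bigD1 (1%g : {perm 'I_n})) //= odd_perm1 expr0 mul1r.
  rewrite [X in _ + X]big1 => [|s sN1].
    rewrite addr0 big1 // => i _.
    by rewrite !mxE perm1 eqxx (negPf (rooted_neq i fr)) subr0.
  have [i0 i0P] : exists i, s i != i.
    by apply/existsP; apply: contraNT sN1 => /existsPn s1; apply/eqP/permP => i;
      rewrite perm1; apply/eqP; rewrite -[_ == _]negbK s1.
  case: (@arg_minnP _ i0 [pred i | s i != i] (fun i => d (lift ord0 i)) i0P).
  move=> i /= sii dmin; rewrite (bigD1 i) //= !mxE eq_sym (negPf sii) sub0r.
  case: eqP => [fi|_]; last by rewrite oppr0 mul0r mulr0.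
  have := dmin (s i); rewrite (inj_eq perm_inj) sii leqNgt => /(_ isT).
  by rewrite -fi dlt.
pose C := [pred i | ~~ fconnect (parent f) i ord0].
apply/eqP; rewrite -det_tr; apply/det0P.
exists (\row_k (C (lift ord0 k))%:R).
  move: fNr => /forallPn[i iC]; have [i0|[k iE]] := ord0_lift_case i.
    by rewrite i0 connect0 in iC.
  apply/eqP => /rowP/(_ k)/eqP; rewrite !mxE /C /= -iE iC.
  by rewrite oner_eq0.
apply/rowP => a; rewrite !mxE.
transitivity ((C (lift ord0 a))%:R - (C (f a))%:R : R).
  under eq_bigr do rewrite !mxE mulrBr.
  rewrite sumrB; congr (_ - _).
    rewrite (bigD1 a) //= eqxx mulr1 big1 ?addr0 // => b ba.
    by rewrite eq_sym (negPf ba) mulr0.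
  have [->|[k ->]] := ord0_lift_case (f a).
    by rewrite /C /= connect0 big1 // => b _; rewrite mulr0.
  rewrite (bigD1 k) //= eqxx mulr1 big1 ?addr0 // => b bk.
  by rewrite (inj_eq lift_inj) eq_sym (negPf bk) mulr0.
suff -> : C (lift ord0 a) = C (f a) by rewrite subrr.
rewrite /C /= -(parent_lift f a); congr (~~ _); apply/idP/idP; last first.
  by apply: connect_trans (fconnect1 _ _).
move=> /iter_findex; case: (findex _ _ _) => [/= /eqP|m].
  by rewrite eq_sym (negPf (neq_lift _ _)).
by rewrite iterSr => {2}<-; apply: fconnect_iter.
Qed.

End ParentMaps.

(** * The weighted matrix-tree theorem *)

Section Laplacian.
Variables (R : fieldType) (n : nat).
Implicit Types w : 'I_n.+1 -> 'I_n.+1 -> R.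

(** Laplacian of a weighted directed graph, with the row and the column of the
    root deleted. Row [a] is written as a combination of differences of basis
    vectors, with the basis vector of the root read as zero; this is the form in
    which multilinearity of the determinant applies. Loops cancel out. *)
Definition laplacian w : 'M[R]_n :=
  \matrix_(a, b) \sum_j w (lift ord0 a) j * ((a == b)%:R - (j == lift ord0 b)%:R).

Definition tree_sum w : R := \sum_(f : {ffun 'I_n -> 'I_n.+1} | rooted f)
  \prod_k w (lift ord0 k) (f k).

(** Directed form of the matrix-tree theorem, by multilinearity in the rows. *)
Lemma det_laplacian w : \det (laplacian w) = tree_sum w.
Proof.
rewrite /determinant.
under eq_bigr => s _.
  under eq_bigr do rewrite mxE.
  rewrite bigA_distr_bigA /= mulr_sumr.
  over.
rewrite exchange_big [RHS]big_mkcond /=; apply: eq_bigr => f _.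
under eq_bigr do rewrite big_split /= mulrCA.
rewrite -mulr_sumr.
transitivity ((\prod_k w (lift ord0 k) (f k)) * (rooted f)%:R); last first.
  by case: rooted; rewrite ?mulr1 ?mulr0.
rewrite -det_parent; congr (_ * _); apply: eq_bigr => s _; congr (_ * _).
by apply: eq_bigr => i _; rewrite mxE.
Qed.

End Laplacian.

(** * Determinant and trace of a positive semidefinite matrix *)

Section PositiveSemidefinite.
Variable R : realFieldType.

Definition psd n (A : 'M[R]_n) :=
  A^T = A /\ forall x : 'rV_n, 0 <= (x *m A *m x^T) 0 0.

Lemma psd_congr m n (M : 'M[R]_(m, n)) (A : 'M_n) :
  psd A -> psd (M *m A *m M^T).
Proof.
move=> [AT Age0]; split; first by rewrite !trmx_mul trmxK AT mulmxA.
by move=> x; have := Age0 (x *m M); rewrite trmx_mul !mulmxA.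
Qed.

Lemma psd_diag_ge0 n (A : 'M[R]_n) i : psd A -> 0 <= A i i.
Proof. by move=> [_ /(_ (delta_mx 0 i))]; rewrite trmx_delta -rowE -colE !mxE. Qed.

(** A zero diagonal entry forces its whole row to vanish: otherwise the form
    would take negative values on combinations of two basis vectors. *)
Lemma psd_diag_gt0 n (A : 'M[R]_n) i : psd A -> 0 < \det A -> 0 < A i i.
Proof.
move=> pA detA; have [AT Age0] := pA; rewrite lt0r psd_diag_ge0 // andbT.
apply/negP => /eqP Aii0; move: detA.
suff Ai0 j : A i j = 0.
  by rewrite (expand_det_row A i) big1 ?ltxx // => j _; rewrite Ai0 mul0r.
apply/eqP/negPn/negP => Aij.
have Aji : A j i = A i j by rewrite -[in LHS]AT mxE.
pose t := - (A j j + 1) / (2 * A i j).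
have := Age0 (t *: delta_mx 0 i + delta_mx 0 j).
rewrite linearD linearZ /= !trmx_delta mulmxDr -scalemxAr !mulmxDl -!scalemxAl.
rewrite -!rowE -!colE !mxE Aii0 Aji.
have -> : t * (t * 0 + A i j) + (t * A i j + A j j) = - 1.
  by rewrite /t; field.
by rewrite ler0N1.
Qed.

Lemma det_schur n (a : R) (b : 'rV[R]_n) (C : 'M_n) : a != 0 ->
  \det (block_mx a%:M b b^T C) = a * \det (C - a^-1 *: (b^T *m b)).
Proof.
move=> a0.
have := det_mulmx (block_mx 1%:M 0 (- a^-1 *: b^T) 1%:M) (block_mx a%:M b b^T C).
rewrite det_lblock !det1 !mul1r => <-.
rewrite mulmx_block !mul1mx !mul0mx !addr0 mul_mx_scalar scalerA mulrN mulfV //.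
rewrite scaleN1r addNr -scalemxAl scaleNr addrC det_ublock.
by rewrite [in LHS]det_scalar1.
Qed.

Lemma psd_schur n (a : R) (b : 'rV[R]_n) (C : 'M_n) : a != 0 ->
  psd (block_mx a%:M b b^T C) -> psd (C - a^-1 *: (b^T *m b)).
Proof.
move=> a0 [AT Age0]; split.
  move: AT; rewrite tr_block_mx => /eq_block_mx[_ _ _ CT].
  by rewrite linearB linearZ /= CT trmx_mul trmxK.
move=> x; pose y := row_mx (- a^-1 *: (x *m b^T)) x.
suff yA : y *m block_mx a%:M b b^T C = row_mx 0 (x *m (C - a^-1 *: (b^T *m b))).
  by have := Age0 y; rewrite yA tr_row_mx mul_row_col mul0mx add0r.
rewrite mul_row_block mul_mx_scalar scalerA mulrN mulfV // scaleN1r addNr.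
by rewrite mulmxBr -scalemxAl -scalemxAr mulmxA scaleNr addrC.
Qed.

Lemma prod_le_eq (I : finType) (E F : I -> R) :
  (forall i, 0 <= E i <= F i) -> 0 < \prod_i F i ->
  \prod_i E i = \prod_i F i -> E =1 F.
Proof.
move=> EF F_gt0 EFeq i; apply/eqP; have /andP[Ei0 EiF] := EF i.
apply/negPn/negP => neq; suff : \prod_j E j < \prod_j F j by rewrite EFeq ltxx.
rewrite (bigD1 i) //= [ltRHS](bigD1 i) //=.
have Fi0 : 0 <= F i by apply: le_trans EiF.
have P_gt0 : 0 < \prod_(j | j != i) F j.
  rewrite lt0r prodr_ge0 ?andbT => [|j _]; last first.
    by case/andP: (EF j) => /le_trans; apply.
  by apply: contraTneq F_gt0 => P0; rewrite (bigD1 i) //= P0 mulr0 ltxx.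
apply: (@le_lt_trans _ _ (E i * \prod_(j | j != i) F j)).
  by apply: ler_wpM2l => //; apply: ler_prod => j _; apply: EF.
by rewrite ltr_pM2r // lt_neqAle neq EiF.
Qed.

(** Hadamard's inequality, by induction on the Schur complement of the first
    diagonal entry, whose diagonal is dominated by the one of the matrix. *)
Lemma hadamard n (A : 'M[R]_n) : psd A -> 0 < \det A ->
  \det A <= \prod_i A i i /\ (\det A = \prod_i A i i -> is_diag_mx A).
Proof.
elim: n A => [|n IH] A pA detA.
  by rewrite det_mx00 big_ord0; split => // _; apply/is_diag_mxP => [[]].
have a_gt0 := psd_diag_gt0 ord0 pA detA.
set a := A 0 0 in a_gt0; have a0 : a != 0 by rewrite gt_eqF.
have [b [C AE]] : exists b : 'rV_n, exists C : 'M_n,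
    A = block_mx a%:M b b^T C :> 'M_(1 + n).
  exists (@ursubmx _ 1 n 1 n A), (@drsubmx _ 1 n 1 n A).
  rewrite -[LHS](@submxK _ 1 n 1 n) trmx_ursub; case: pA => -> _.
  congr block_mx; rewrite [LHS]mx11_scalar; congr (_%:M); rewrite !mxE.
  by congr (A _ _); apply: val_inj.
move: pA detA; rewrite AE => pA; rewrite det_schur // pmulr_rgt0 // => detS.
have pS := psd_schur a0 pA; have [detSle Sdiag] := IH _ pS detS.
set S := C - _ in detS pS detSle Sdiag *.
have SE i : S i i = C i i - a^-1 * b 0 i ^+ 2.
  by rewrite !mxE big_ord1 !mxE expr2.
have SC i : 0 <= S i i <= C i i.
  rewrite psd_diag_ge0 //= SE gerBl mulr_ge0 ?sqr_ge0 // invr_ge0 ltW //.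
have prodSC : \prod_i S i i <= \prod_i C i i by apply: ler_prod => i _; apply: SC.
have -> : \prod_i (block_mx a%:M b b^T C : 'M_(1 + n)) i i = a * \prod_i C i i.
  rewrite (@big_split_ord _ _ _ 1 n) big_ord1 block_mxEul mxE eqxx; congr (_ * _).
  by apply: eq_bigr => i _; rewrite block_mxEdr.
split; first by rewrite ler_pM2l //; apply: le_trans prodSC.
move=> /(mulfI a0) detSC.
have prodSS : \prod_i S i i = \prod_i C i i.
  by apply/le_anti; rewrite prodSC -detSC.
have C_gt0 : 0 < \prod_i C i i by rewrite -detSC.
have b0 : b = 0.
  apply/rowP => i; rewrite mxE; have /eqP := prod_le_eq SC C_gt0 prodSS i.
  rewrite SE -subr_eq0 addrAC subrr add0r oppr_eq0 mulf_eq0 invr_eq0 (negPf a0).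
  by rewrite expf_eq0 => /eqP.
have SC_eq : S = C by rewrite /S b0 mulmx0 scaler0 subr0.
have diagA : is_diag_mx (block_mx a%:M 0 0 C : 'M_(1 + n)).
  rewrite is_diag_block_mx // !eqxx scalar_mx_is_diag -SC_eq Sdiag //.
  by rewrite detSC prodSS.
by rewrite b0 trmx0; exact: diagA.
Qed.

(** Arithmetic-geometric mean inequality for the eigenvalues, obtained from the
    one for the diagonal entries. *)
Lemma det_le_trace n (A : 'M[R]_n) : psd A -> 0 < \det A ->
  \det A <= (\tr A / n%:R) ^+ n /\
  (\det A = (\tr A / n%:R) ^+ n -> is_scalar_mx A).
Proof.
move=> pA detA; have [detle detdiag] := hadamard pA detA.
have /leifP := @leif_AGM R 'I_n predT (fun i => A i i)
  (fun i _ => psd_diag_ge0 i pA).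
rewrite card_ord -/(\tr A) => agm.
have prodle : \prod_i A i i <= (\tr A / n%:R) ^+ n.
  by case: ifP agm => _ => [/eqP->|/ltW].
split=> [|detE]; first exact: le_trans prodle.
have prodE : \prod_i A i i = (\tr A / n%:R) ^+ n.
  by apply/le_anti; rewrite prodle -detE.
case: ifP agm => [/'forall_'forall_eqP Aeq _|_]; last by rewrite prodE ltxx.
have /is_diag_mxP Adiag := detdiag (etrans detE (esym prodE)).
case: n A {pA detA detle detdiag prodle detE prodE} Aeq Adiag
  => [|n] A Aeq Adiag; first by apply/is_scalar_mxP; exists 0; apply/matrixP => [[]].
apply/is_scalar_mxP; exists (A 0 0); apply/matrixP => i j; rewrite mxE.
by have [<-|ij] := eqVneq i j; [rewrite mulr1n; apply: Aeq | rewrite mulr0n Adiag].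
Qed.

End PositiveSemidefinite.

(** * The quadratic form of a Laplacian *)

Section LaplacianForm.
Variables (R : realFieldType) (n : nat).
Implicit Types w F : 'I_n.+1 -> 'I_n.+1 -> R.

Definition edge_sum F : R := \sum_(i < n.+1) \sum_(j < n.+1 | (i < j)%N) F i j.

Lemma sum_edge_sum F : (forall i, F i i = 0) ->
  \sum_i \sum_j F i j = edge_sum (fun i j => F i j + F j i).
Proof.
move=> F0; rewrite /edge_sum; under [RHS]eq_bigr do rewrite big_split /=.
rewrite big_split /= [X in _ + X](exchange_big_dep xpredT) //= -big_split /=.
apply: eq_bigr => i _; rewrite (bigD1 i) //= F0 add0r.
rewrite (bigID (fun j : 'I_n.+1 => (i < j)%N)) /=; congr (_ + _); apply: eq_bigl => j.
  by rewrite -(inj_eq val_inj) /=; case: ltngtP.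
by rewrite -(inj_eq val_inj) /=; case: ltngtP.
Qed.

Lemma laplacianE w a b : laplacian w a b =
  (a == b)%:R * \sum_j w (lift ord0 a) j - w (lift ord0 a) (lift ord0 b).
Proof.
rewrite mxE; under eq_bigr do rewrite mulrBr.
rewrite sumrB -mulr_suml mulrC; congr (_ - _).
rewrite (bigD1 (lift ord0 b)) //= eqxx mulr1 big1 ?addr0 // => j /negPf->.
by rewrite mulr0.
Qed.

(** Functions vanishing at the root are the functions on non-root vertices, so
    the reduced Laplacian has the bilinear form of the full one. *)
Lemma laplacian_form w (x z : 'I_n.+1 -> R) :
  (forall i j, w i j = w j i) -> x ord0 = 0 -> z ord0 = 0 ->
  \sum_a \sum_b x (lift ord0 a) * laplacian w a b * z (lift ord0 b) =
  edge_sum (fun i j => w i j * ((x i - x j) * (z i - z j))).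
Proof.
move=> wC x0 z0.
transitivity (\sum_i \sum_j w i j * (x i * (z i - z j))).
  rewrite big_ord_recl [X in _ = X + _]big1 ?add0r; last first.
    by move=> j _; rewrite x0 mul0r mulr0.
  apply: eq_bigr => a _.
  under eq_bigr do rewrite laplacianE -mulrA mulrBl.
  rewrite -mulr_sumr sumrB.
  rewrite (bigD1 a) //= eqxx mul1r [X in _ + X - _]big1 ?addr0; last first.
    by move=> b; rewrite eq_sym => /negPf->; rewrite !mul0r.
  under [RHS]eq_bigr do rewrite mulrCA mulrBr.
  rewrite -mulr_sumr sumrB -mulr_suml; congr (_ * (_ - _)).
  by rewrite big_ord_recl z0 mulr0 add0r.
rewrite sum_edge_sum => [|i]; last by rewrite subrr !mulr0.
by apply: eq_bigr => i _; apply: eq_bigr => j _; rewrite (wC j i); ring.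
Qed.

Lemma laplacian_sym w : (forall i j, w i j = w j i) -> (laplacian w)^T = laplacian w.
Proof.
move=> wC; apply/matrixP => a b; rewrite mxE !laplacianE (wC (lift ord0 b)) eq_sym.
by case: eqP => [->|]; rewrite ?mul0r.
Qed.

Lemma ler_edge_sum F : (forall i j, i != j -> 0 <= F i j) -> 0 <= edge_sum F.
Proof.
move=> F0; apply: sumr_ge0 => i _; apply: sumr_ge0 => j ij; apply: F0.
by rewrite -(inj_eq val_inj) /= ltn_eqF.
Qed.

Lemma eq_edge_sum F G : (forall i j, i != j -> F i j = G i j) ->
  edge_sum F = edge_sum G.
Proof.
move=> FG; apply: eq_bigr => i _; apply: eq_bigr => j ij; apply: FG.
by rewrite -(inj_eq val_inj) /= ltn_eqF.
Qed.

(** Prepending a zero makes a row vector a function on all vertices. *)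
Definition pad (x : 'rV[R]_n) (i : 'I_n.+1) : R :=
  if unlift ord0 i is Some a then x 0 a else 0.

Lemma pad0 x : pad x ord0 = 0. Proof. by rewrite /pad unlift_none. Qed.

Lemma pad_lift x a : pad x (lift ord0 a) = x 0 a.
Proof. by rewrite /pad liftK. Qed.

Lemma psd_laplacian w : (forall i j, w i j = w j i) ->
  (forall i j, i != j -> 0 <= w i j) -> psd (laplacian w).
Proof.
move=> wC w0; split; first exact: laplacian_sym.
move=> x; suff -> : (x *m laplacian w *m x^T) 0 0 =
    edge_sum (fun i j => w i j * ((pad x i - pad x j) * (pad x i - pad x j))).
  by apply: ler_edge_sum => i j ij; rewrite mulr_ge0 ?w0 // -expr2 sqr_ge0.
rewrite -laplacian_form ?pad0 // exchange_big mxE; apply: eq_bigr => b _.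
by rewrite !mxE mulr_suml; apply: eq_bigr => a _; rewrite !pad_lift.
Qed.

Lemma tree_sum_ge0 w : (forall i j, i != j -> 0 <= w i j) -> 0 <= tree_sum w.
Proof.
move=> w0; apply: sumr_ge0 => f fr; apply: prodr_ge0 => k _.
by apply: w0; rewrite eq_sym rooted_neq.
Qed.

(** Equality is analysed only for a positive trace: a zero determinant gives no
    information on the matrix. *)
Lemma tree_sum_le_trace w (M : 'M_n) :
  (forall i j, w i j = w j i) -> (forall i j, i != j -> 0 <= w i j) ->
  let A := M *m laplacian w *m M^T in
  let t := (\tr A / n%:R) ^+ n in
  \det M ^+ 2 * tree_sum w <= t /\
  (0 < t -> \det M ^+ 2 * tree_sum w = t -> is_scalar_mx A).
Proof.
move=> wC w0 A t.
have pA : psd A by apply: psd_congr; apply: psd_laplacian.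
have -> : \det M ^+ 2 * tree_sum w = \det A.
  by rewrite /A !det_mulmx det_tr det_laplacian; ring.
have t0 : 0 <= t.
  by rewrite exprn_ge0 // divr_ge0 // sumr_ge0 // => i _; apply: psd_diag_ge0.
have [detA|detA] := ltP 0 (\det A).
  by have [? ?] := det_le_trace pA detA; split.
by split; [exact: le_trans t0 | move=> t_gt0 tE; rewrite tE leNgt t_gt0 in detA].
Qed.

(** The matrix [1 + J], with [J] all ones, is the Gram matrix of the edges at one
    vertex of a regular simplex of edge length the square root of two. *)
Definition simplex_gram : 'M[R]_n := 1%:M + const_mx 1.

Lemma simplex_gramE a b : simplex_gram a b = (a == b)%:R + 1.
Proof. by rewrite !mxE. Qed.

(** The bordered matrix [B] is reduced to triangular form in two ways, by
    eliminating either of its two diagonal blocks. *)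
Lemma det_simplex_gram : \det simplex_gram = n.+1%:R.
Proof.
pose u : 'rV[R]_n := const_mx 1.
pose B := block_mx 1%:M (- u) u^T 1%:M : 'M_(1 + n).
have uu : u *m u^T = n%:R%:M.
  apply/matrixP => i j; rewrite !mxE !ord1 eqxx mulr1n.
  by under eq_bigr do rewrite !mxE mulr1; rewrite sumr_const card_ord.
have <- : \det B = \det simplex_gram.
  have := det_mulmx (block_mx 1%:M 0 (- u^T) 1%:M) B.
  rewrite det_lblock !det1 !mul1r => <-.
  rewrite mulmx_block !mul1mx !mul0mx !addr0 mulmx1 addNr det_ublock det1 mul1r.
  congr (\det _); rewrite mulmxN mulNmx opprK addrC; congr (_ + _).
  by apply/matrixP => i j; rewrite !mxE big_ord1 !mxE mulr1.
have := det_mulmx (block_mx 1%:M u 0 1%:M) B.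
rewrite det_ublock !det1 !mul1r => <-.
rewrite mulmx_block !mul1mx !mul0mx !add0r mulmx1 addNr det_lblock det1 mulr1 uu.
by rewrite -raddfD det_scalar1 /= -natr1 addrC.
Qed.

Lemma mul_laplacian_gram w a b :
  (laplacian w *m simplex_gram) a b = laplacian w a b + w (lift ord0 a) ord0.
Proof.
rewrite mulmxDr mulmx1 mxE; congr (_ + _); rewrite mxE.
under eq_bigr do rewrite laplacianE mxE mulr1.
rewrite sumrB (bigD1 a) //= eqxx mul1r [X in _ + X - _]big1 ?addr0; last first.
  by move=> c; rewrite eq_sym => /negPf->; rewrite mul0r.
by rewrite big_ord_recl addrK.
Qed.

Lemma tr_laplacian_gram w : (forall i j, w i j = w j i) ->
  \tr (laplacian w *m simplex_gram) = 2 * edge_sum w.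
Proof.
move=> wC.
transitivity (\sum_i \sum_j (i != j)%:R * w i j); last first.
  rewrite sum_edge_sum => [|i]; last by rewrite eqxx mul0r.
  rewrite /edge_sum mulr_sumr; apply: eq_bigr => i _.
  rewrite mulr_sumr; apply: eq_bigr => j ij.
  have ij' : i != j by rewrite -(inj_eq val_inj) /= ltn_eqF.
  by rewrite [j == i]eq_sym ij' !mul1r (wC j i); ring.
rewrite [RHS]big_ord_recl [X in _ = X + _](bigD1 ord0) //= mul0r add0r addrC.
have -> : \sum_(j | j != ord0) (ord0 != j)%:R * w ord0 j
        = \sum_(a < n) w (lift ord0 a) ord0.
  rewrite big_mkcond big_ord_recl eqxx /= add0r; apply: eq_bigr => a _.
  by rewrite /= mul1r wC.
rewrite -big_split /=; apply: eq_bigr => a _.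
rewrite mul_laplacian_gram laplacianE eqxx mul1r; congr (_ + _).
rewrite (bigD1 (lift ord0 a)) //= addrAC subrr add0r [RHS](bigD1 (lift ord0 a)) //=.
rewrite eqxx mul0r add0r; apply: eq_bigr => j.
by rewrite eq_sym => ->; rewrite mul1r.
Qed.

(** The Gram matrix is, up to a factor, the inverse of the Laplacian of the
    complete graph with constant weights. *)
Lemma laplacian_const_gram w r : (forall i j, i != j -> w i j = r) ->
  laplacian w *m simplex_gram = (r * n.+1%:R)%:M.
Proof.
move=> wr; apply/matrixP => a b; rewrite mul_laplacian_gram laplacianE mxE.
have [<-|ab] := eqVneq a b; last first.
  by rewrite mul0r sub0r !wr ?addNr // (inj_eq lift_inj).
rewrite mul1r (bigD1 (lift ord0 a)) //= [X in X - _]addrC addrK.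
under eq_bigr => j ja do rewrite wr 1?eq_sym //.
rewrite sumr_const cardC1 card_ord wr // mulr1n -mulr_natr -natr1; ring.
Qed.

Lemma tree_sum_const w r : (forall i j, i != j -> w i j = r) ->
  tree_sum w * n.+1%:R = (r * n.+1%:R) ^+ n.
Proof.
move=> wr; rewrite -det_laplacian -[X in _ * X = _]det_simplex_gram -det_mulmx.
by rewrite (laplacian_const_gram wr) det_scalar.
Qed.

(** Going from [a] to the root through [a b] and [b 0] links any two edges at the
    root. *)
Lemma edges_const F : (0 < n)%N -> (forall i j, F i j = F j i) ->
  (forall a b, a != b -> F (lift ord0 a) (lift ord0 b) = F (lift ord0 a) ord0) ->
  exists c, forall i j, i != j -> F i j = c.
Proof.
move=> n0 FC Fab; pose a0 := Ordinal n0; exists (F (lift ord0 a0) ord0).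
have Fa a : F (lift ord0 a) ord0 = F (lift ord0 a0) ord0.
  have [->//|aa0] := eqVneq a a0.
  by rewrite -(Fab _ _ aa0) FC Fab // eq_sym.
move=> i j; have [->|[a ->]] := ord0_lift_case i; have [->|[b ->]] := ord0_lift_case j.
- by rewrite eqxx.
- by move=> _; rewrite FC Fa.
- by move=> _; rewrite Fa.
- by rewrite (inj_eq lift_inj) => ab; rewrite Fab // Fa.
Qed.

End LaplacianForm.

(** * Cauchy-Schwarz over spanning trees *)

(** Lagrange's identity for the vectors of entries [sqrt (A i / B i)] and
    [sqrt (A i * B i)], written without square roots. *)
Lemma sum_mul_sum_eq (R : realFieldType) (I : finType) (P : pred I) (A B : I -> R) :
  (forall i, P i -> 0 < B i) ->
  2 * ((\sum_(i | P i) A i / B i) * (\sum_(i | P i) A i * B i) -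
       (\sum_(i | P i) A i) ^+ 2) =
  \sum_(i | P i) \sum_(j | P j) A i * A j * (B i - B j) ^+ 2 / (B i * B j).
Proof.
move=> B0; symmetry.
under eq_bigr => i Pi.
  rewrite (eq_bigr (fun j => A i / B i * (A j * B j) + A i * B i * (A j / B j)
                             - 2 * A i * A j)); last first.
    by move=> j Pj; field; rewrite !gt_eqF ?B0.
  rewrite sumrB big_split /= -!mulr_sumr; over.
rewrite sumrB big_split /= -!mulr_suml -mulr_sumr expr2; ring.
Qed.

Section TreeCauchySchwarz.
Variables (R : realFieldType) (n : nat) (rho l : 'I_n.+1 -> 'I_n.+1 -> R).
Hypothesis rho_ge0 : forall i j, i != j -> 0 <= rho i j.
Hypothesis l_gt0 : forall i j, i != j -> 0 < l i j.

Let tq := tree_sum (fun i j => rho i j * l i j).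
Let ty := tree_sum (fun i j => rho i j / l i j).

Let A (f : {ffun 'I_n -> 'I_n.+1}) := \prod_k rho (lift ord0 k) (f k).
Let B (f : {ffun 'I_n -> 'I_n.+1}) := \prod_k l (lift ord0 k) (f k).

Let neq (f : {ffun 'I_n -> 'I_n.+1}) k : rooted f -> lift ord0 k != f k.
Proof. by move=> fr; rewrite eq_sym rooted_neq. Qed.

Let B_gt0 f : rooted f -> 0 < B f.
Proof. by move=> fr; apply: prodr_gt0 => k _; apply/l_gt0/neq. Qed.

Let A_ge0 f : rooted f -> 0 <= A f.
Proof. by move=> fr; apply: prodr_ge0 => k _; apply/rho_ge0/neq. Qed.

Let tree_sum_gap : 2 * (ty * tq - tree_sum rho ^+ 2) =
  \sum_(f | rooted f) \sum_(g | rooted g) A f * A g * (B f - B g) ^+ 2 / (B f * B g).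
Proof.
rewrite -sum_mul_sum_eq // /tq /ty /tree_sum; congr (2 * (_ * _ - _)).
  by apply: eq_bigr => f _; rewrite /A /B prodf_div.
by apply: eq_bigr => f _; rewrite /A /B big_split.
Qed.

Let term_ge0 f g : rooted f -> rooted g ->
  0 <= A f * A g * (B f - B g) ^+ 2 / (B f * B g).
Proof.
move=> fr gr; have /ltW Bf := B_gt0 fr; have /ltW Bg := B_gt0 gr.
apply: divr_ge0; last exact: mulr_ge0.
by apply: mulr_ge0 (sqr_ge0 _); apply: mulr_ge0; apply: A_ge0.
Qed.

Lemma tree_sum_CauchySchwarz : tree_sum rho ^+ 2 <= ty * tq.
Proof.
rewrite -subr_ge0 -(@pmulr_rge0 _ 2) // tree_sum_gap.
by apply: sumr_ge0 => f fr; apply: sumr_ge0 => g gr; apply: term_ge0.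
Qed.

Lemma tree_sum_CauchySchwarz_eq :
  (forall i j, i != j -> 0 < rho i j) -> tree_sum rho ^+ 2 = ty * tq ->
  forall f g, rooted f -> rooted g -> B f = B g.
Proof.
move=> rho_gt0 eqn f g fr gr.
have A_gt0 h : rooted h -> 0 < A h.
  by move=> hr; apply: prodr_gt0 => k _; apply/rho_gt0/neq.
have /esym/eqP := tree_sum_gap; rewrite eqn subrr mulr0 psumr_eq0; last first.
  by move=> h hr; apply: sumr_ge0 => h' hr'; apply: term_ge0.
move=> /allP/(_ f (mem_index_enum _)); rewrite fr implyTb psumr_eq0; last first.
  by move=> h' hr'; apply: term_ge0.
move=> /allP/(_ g (mem_index_enum _)); rewrite gr implyTb mulf_eq0 invr_eq0.
rewrite !mulf_eq0 !(gt_eqF (A_gt0 _ _)) // !(gt_eqF (B_gt0 _)) // !orbF /=.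
by rewrite orbb subr_eq0 => /eqP.
Qed.

(** Only two kinds of trees are compared: the star at the root, and the star in
    which one leaf is reattached to another leaf. *)
Lemma tree_prod_const : (0 < n)%N -> (forall i j, l i j = l j i) ->
  (forall f g, rooted f -> rooted g -> B f = B g) ->
  exists c, forall i j, i != j -> l i j = c.
Proof.
move=> n0 lC Bconst; apply: edges_const => // a b ab.
pose star : {ffun 'I_n -> 'I_n.+1} := [ffun=> ord0].
pose bent : {ffun 'I_n -> 'I_n.+1} := [ffun k => if k == a then lift ord0 b else ord0].
have star_r : rooted star.
  by apply/rootedP; exists (fun i => i != ord0 : nat) => k; rewrite ffunE.
have bent_r : rooted bent.
  apply/rootedP; exists (fun i => (i != ord0) + (i == lift ord0 a))%N => k.
  rewrite ffunE (inj_eq lift_inj); case: (k == a) => //=.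
  by rewrite (inj_eq lift_inj) eq_sym (negPf ab).
have := Bconst _ _ bent_r star_r; rewrite /B (bigD1 a) //= [in RHS](bigD1 a) //=.
rewrite !ffunE eqxx.
rewrite (eq_bigr (fun k => l (lift ord0 k) (star k))); last first.
  by move=> k /negPf ka; rewrite !ffunE ka.
apply: mulIf; rewrite gt_eqF //; apply: prodr_gt0 => k _; apply: l_gt0.
exact: neq.
Qed.

End TreeCauchySchwarz.

(** * Trees and total weight *)

(** The square root of [simplex_gram] turns the trace of a Laplacian into the
    total weight, so that the determinant bound becomes a bound on [tree_sum]. *)
Lemma simplex_gram_sqrt (R : rcfType) (n : nat) : (0 < n)%N ->
  exists K : 'M[R]_n, K^T = K /\ K *m K = simplex_gram R n.
Proof.
move=> n0.
(* As the square of the all-ones matrix is [n] times itself, [a] has to solve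
   [n * a ^ 2 + 2 * a = 1]. *)
pose s : R := Num.sqrt n.+1%:R; pose a := (s - 1) / n%:R.
have nz : n%:R != 0 :> R by rewrite pnatr_eq0 -lt0n.
have ss : s ^+ 2 = n%:R + 1 by rewrite sqr_sqrtr ?ler0n // -natr1.
exists (1%:M + a *: const_mx 1); split.
  by rewrite linearD linearZ /= trmx1 trmx_const.
have JJ : (const_mx 1 : 'M_n) *m const_mx 1 = n%:R *: const_mx 1 :> 'M[R]_n.
  apply/matrixP => i j; rewrite !mxE; under eq_bigr do rewrite !mxE mulr1.
  by rewrite sumr_const card_ord mulr1.
rewrite mulmxDr !mulmxDl !mulmx1 !mul1mx -scalemxAl -scalemxAr JJ !scalerA.
rewrite /simplex_gram -addrA; congr (_ + _); rewrite -!scalerDl.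
have -> : a + (a + a * a * n%:R) = 1.
  by rewrite /a; field: ss.
by rewrite scale1r.
Qed.

Section TotalWeight.
Variables (R : rcfType) (n : nat) (w : 'I_n.+1 -> 'I_n.+1 -> R).
Hypothesis n_gt0 : (0 < n)%N.
Hypothesis wC : forall i j, w i j = w j i.
Hypothesis w_ge0 : forall i j, i != j -> 0 <= w i j.

(** This is [tree_sum_le_trace] for a regular simplex. In the equality case [L]
    times [1 + J] is scalar, where [L] is the Laplacian; its off-diagonal entry at
    [a], [b] is the weight of the edge from [a] to the root minus that of the edge
    from [a] to [b]. *)
Lemma tree_sum_le_edge_sum :
  n.+1%:R * tree_sum w <= (2 * edge_sum w / n%:R) ^+ n /\
  (0 < edge_sum w -> n.+1%:R * tree_sum w = (2 * edge_sum w / n%:R) ^+ n ->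
   exists c, forall i j, i != j -> w i j = c).
Proof.
have [K [KT KK]] := simplex_gram_sqrt R n_gt0.
have := tree_sum_le_trace K wC w_ge0; cbv zeta; rewrite KT.
rewrite expr2 -det_mulmx KK det_simplex_gram.
rewrite -mulmxA mxtrace_mulC -mulmxA KK tr_laplacian_gram // mulmxA.
move=> [le eq]; split=> // w_gt0 /eq.
have -> : 0 < (2 * edge_sum w / n%:R) ^+ n.
  by rewrite exprn_gt0 // divr_gt0 ?mulr_gt0 ?ltr0n.
move=> /(_ isT) /is_scalar_mxP[c KLK].
have Ku : K \in unitmx.
  rewrite unitmxE unitfE; apply/eqP => K0.
  have := det_simplex_gram R n; rewrite -KK det_mulmx K0 mul0r => /esym/eqP.
  by rewrite pnatr_eq0.
have LG : laplacian w *m simplex_gram R n = c%:M.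
  rewrite -KK mulmxA -[LHS](mulKmx Ku) (mulmxA K) (mulmxA K (laplacian w)) KLK.
  by rewrite mul_scalar_mx -scalemxAr mulVmx // scalemx1.
apply: edges_const => // a b ab.
have /matrixP/(_ a b) := LG; rewrite mul_laplacian_gram laplacianE mxE (negPf ab).
by rewrite mul0r sub0r mulr0n addrC => /subr0_eq.
Qed.

End TotalWeight.

(** * Edge vectors of a simplex *)

Section Simplex.
Variables (R : realType) (n : nat) (v : 'I_n.+1 -> 'cV[R]_n).

Definition edge_mx : 'M[R]_n := \matrix_(i, j) (v (lift ord0 j) - v ord0) i 0.

Lemma edge_absdetE : edge_absdet v = `|\det edge_mx|. Proof. by []. Qed.

Lemma edge_length_sqr i j :
  edge_length v i j ^+ 2 = \sum_k ((v i - v j) k 0) ^+ 2.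
Proof. by rewrite sqr_sqrtr // sumr_ge0 // => k _; apply: sqr_ge0. Qed.

Lemma edge_lengthC i j : edge_length v i j = edge_length v j i.
Proof.
congr (Num.sqrt _); apply: eq_bigr => k _.
by rewrite -opprB mxE sqrrN.
Qed.

Lemma edge_length_gt0 i j : affinely_independent v -> i != j -> 0 < edge_length v i j.
Proof.
move=> vind ij; rewrite lt0r sqrtr_ge0 andbT; apply/negP => /eqP l0.
have vij : v i = v j.
  apply/subr0_eq/colP => k; rewrite [RHS]mxE; apply/eqP; rewrite -sqrf_eq0.
  have := edge_length_sqr i j; rewrite l0 expr0n /= => /esym/eqP.
  by rewrite psumr_eq0 => [/allP/(_ k (mem_index_enum _))|k' _]; rewrite ?sqr_ge0.
have ji : (j == i) = false by rewrite eq_sym (negPf ij).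
have := vind (fun k => (k == i)%:R - (k == j)%:R).
have sum1 (k : 'I_n.+1) : \sum_(k' : 'I_n.+1) (k' == k)%:R = 1 :> R.
  by rewrite (bigD1 k) //= eqxx big1 ?addr0 // => k' /negPf->.
have sumv (k : 'I_n.+1) : \sum_k' (k' == k)%:R *: v k' = v k.
  by rewrite (bigD1 k) //= eqxx scale1r big1 ?addr0 // => k' /negPf->; rewrite scale0r.
rewrite sumrB !sum1 subrr => /(_ erefl).
under eq_bigr do rewrite scalerBl.
rewrite sumrB !sumv vij subrr => /(_ erefl i) /eqP.
by rewrite eqxx (negPf ij) subr0 oner_eq0.
Qed.

Lemma tr_edge_laplacian (w : 'I_n.+1 -> 'I_n.+1 -> R) : (forall i j, w i j = w j i) ->
  \tr (edge_mx *m laplacian w *m edge_mx^T) =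
  edge_sum (fun i j => w i j * edge_length v i j ^+ 2).
Proof.
move=> wC; pose x k i := (v i - v ord0) k 0.
transitivity (\sum_k edge_sum (fun i j => w i j * ((x k i - x k j) * (x k i - x k j)))).
  apply: eq_bigr => k _; rewrite -laplacian_form //; try by rewrite /x subrr mxE.
  rewrite exchange_big mxE; apply: eq_bigr => b _.
  rewrite [(edge_mx *m _) k b]mxE mulr_suml; apply: eq_bigr => a _.
  by rewrite [edge_mx^T _ _]mxE ![edge_mx _ _]mxE.
rewrite /edge_sum exchange_big; apply: eq_bigr => i _.
rewrite exchange_big; apply: eq_bigr => j _.
rewrite edge_length_sqr mulr_sumr; apply: eq_bigr => k _.
by rewrite -expr2 /x !mxE; congr (_ * _ ^+ 2); ring.
Qed.

(** By polarization, the Gram matrix of the edge vectors is a multiple of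
    [simplex_gram]. *)
Lemma regular_edge_absdet l : (forall i j, i != j -> edge_length v i j = l) ->
  edge_absdet v ^+ 2 = (l ^+ 2 / 2) ^+ n * n.+1%:R.
Proof.
move=> vl; rewrite edge_absdetE real_normK ?num_real //.
rewrite -(det_simplex_gram R n) -detZ expr2.
rewrite -[X in X * _ = _]det_tr -det_mulmx; congr (\det _).
apply/matrixP => a b; rewrite [RHS]mxE simplex_gramE mxE.
have polar : \sum_j edge_mx^T a j * edge_mx j b =
  (edge_length v (lift ord0 a) ord0 ^+ 2 + edge_length v (lift ord0 b) ord0 ^+ 2
   - edge_length v (lift ord0 a) (lift ord0 b) ^+ 2) / 2.
  rewrite !edge_length_sqr -big_split -sumrB mulr_suml; apply: eq_bigr => k _.
  by rewrite !mxE /=; field.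
rewrite polar (vl _ ord0) // (vl (lift ord0 b)) //; have [<-|ab] := eqVneq a b.
  rewrite edge_length_sqr big1 => [|k _]; last by rewrite subrr mxE expr0n.
  by rewrite mulr1n; field.
by rewrite vl ?(inj_eq lift_inj) // mulr0n; field.
Qed.

End Simplex.

Lemma tree_bound_pow (R : realType) (n : nat) (x : R) : (0 < n)%N -> 0 <= x ->
  (tree_cst R n * x `^ (n%:R)^-1) ^+ (2 * n)
  = (n%:R ^+ 2 / 2) ^+ n * n.+1%:R * x ^+ 2.
Proof.
move=> n0 x0; have nz : n%:R != 0 :> R by rewrite pnatr_eq0 -lt0n.
rewrite /tree_cst !exprMn; congr (_ * _ * _).
- by rewrite exprM exprVn exprM sqr_sqrtr // -exprVn -exprMn.
- rewrite -powR_mulrn ?powR_ge0 // -powRrM mulVf ?powRr1 //.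
  by rewrite pnatr_eq0 muln_eq0 negb_or -!lt0n.
by rewrite mulnC exprM -[X in X ^+ 2]powR_mulrn ?powR_ge0 // -powRrM mulVf ?powRr1.
Qed.

(** * The inequality and its equality case *)

Theorem theorem2p2 (R : realType) (n : nat) (hn : (2 <= n)%N)
    (v : 'I_n.+1 -> 'cV[R]_n) (hv : affinely_independent v)
    (rho : {set 'I_n.+1} -> R)
    (rho_ge0 : forall e, e \in edges n -> 0 <= rho e)
    (tau_gt0 : 0 < spanning_tree_poly rho) :
  tree_cst R n * (edge_absdet v * spanning_tree_poly rho) `^ (n%:R)^-1
    <= weighted_length v rho /\
  (weighted_length v rho
     = tree_cst R n * (edge_absdet v * spanning_tree_poly rho) `^ (n%:R)^-1
   <-> regular_simplex v /\
       (forall e f, e \in edges n -> f \in edges n -> rho e = rho f)).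
Proof.
have n_gt0 : (0 < n)%N by apply: ltnW.
have nz : n%:R != 0 :> R by rewrite pnatr_eq0 -lt0n.
pose r i j := rho [set i; j]%SET; pose l := edge_length v.
have edge_set i j : i != j -> [set i; j]%SET \in edges n.
  by move=> ij; rewrite inE cards2 ij.
have r_ge0 i j : i != j -> 0 <= r i j by move=> ij; apply/rho_ge0/edge_set.
have l_gt0 i j : i != j -> 0 < l i j by apply: edge_length_gt0.
have rC i j : r i j = r j i by rewrite /r setUC.
have lC i j : l i j = l j i by apply: edge_lengthC.
move: tau_gt0; rewrite spanning_tree_polyE -/(tree_sum r) => tau_gt0.
set t := tree_sum r in tau_gt0 *; set S := weighted_length v rho.
set X := tree_cst R n * _.
pose q i j := r i j * l i j; pose y i j := r i j / l i j.
have SE : S = edge_sum q by [].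
have qC i j : q i j = q j i by rewrite /q rC lC.
have yC i j : y i j = y j i by rewrite /y rC lC.
have q_ge0 i j : i != j -> 0 <= q i j.
  by move=> ij; rewrite mulr_ge0 ?r_ge0 // ltW ?l_gt0.
have y_ge0 i j : i != j -> 0 <= y i j.
  by move=> ij; rewrite divr_ge0 ?r_ge0 // ltW ?l_gt0.
have S_ge0 : 0 <= S by rewrite SE; apply: ler_edge_sum.
set d2 := edge_absdet v ^+ 2; have d2_ge0 : 0 <= d2 by apply: sqr_ge0.
(* Both sides are nonnegative, so they are compared through their [2n]-th
   powers, which removes the roots and the absolute value. *)
have X_ge0 : 0 <= X.
  by rewrite mulr_ge0 ?powR_ge0 // mulr_ge0 ?powR_ge0 // divr_ge0 ?ler0n ?sqrtr_ge0.
have dt_ge0 : 0 <= edge_absdet v * t by rewrite mulr_ge0 ?normr_ge0 // ltW.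
have XE : X ^+ (2 * n) = (n%:R ^+ 2 / 2) ^+ n * (n.+1%:R * (d2 * t ^+ 2)).
  by rewrite tree_bound_pow // -mulrA (exprMn _ (edge_absdet v)).
have CS : t ^+ 2 <= tree_sum y * tree_sum q by apply: tree_sum_CauchySchwarz.
have ty_le : d2 * tree_sum y <= (S / n%:R) ^+ n.
  have [le _] := tree_sum_le_trace (edge_mx v) yC y_ge0.
  rewrite /d2 edge_absdetE real_normK ?num_real //; apply: le_trans le _.
  rewrite tr_edge_laplacian // SE (_ : edge_sum _ = edge_sum q) //.
  by apply: eq_edge_sum => i j ij; rewrite /y /q -/(l i j); field; rewrite gt_eqF ?l_gt0.
have [tq_le tq_eq] := tree_sum_le_edge_sum n_gt0 qC q_ge0.
rewrite -SE in tq_le tq_eq.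
have ty_ge0 : 0 <= tree_sum y by apply: tree_sum_ge0.
have tq_ge0 : 0 <= tree_sum q by apply: tree_sum_ge0.
have SnE : S ^+ (2 * n) =
    (n%:R ^+ 2 / 2) ^+ n * ((S / n%:R) ^+ n * (2 * S / n%:R) ^+ n).
  by rewrite exprM -!exprMn; congr (_ ^+ _); field.
have c_gt0 : 0 < (n%:R ^+ 2 / 2) ^+ n :> R.
  by rewrite exprn_gt0 // divr_gt0 // exprn_gt0 // ltr0n.
have chain : n.+1%:R * (d2 * t ^+ 2) <= (d2 * tree_sum y) * (n.+1%:R * tree_sum q).
  rewrite [leRHS]mulrCA ler_pM2l ?ltr0n // -[leRHS]mulrA; exact: ler_wpM2l.
have chain2 : (d2 * tree_sum y) * (n.+1%:R * tree_sum q)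
    <= (S / n%:R) ^+ n * (2 * S / n%:R) ^+ n.
  by apply: ler_pM => //; rewrite mulr_ge0 ?ler0n.
have XS : X ^+ (2 * n) <= S ^+ (2 * n).
  by rewrite XE SnE ler_pM2l //; apply: le_trans chain2.
have n2 : (0 < 2 * n)%N by rewrite muln_gt0.
split; first by rewrite -(ler_pXn2r n2).
split=> [SX | [vreg rconst]].
- (* If [S] were zero, so would be [tree_sum q], hence [t]. *)
  have S_gt0 : 0 < S.
    rewrite lt0r S_ge0 andbT; apply: contraTneq tau_gt0 => S0.
    have tq0 : tree_sum q = 0.
      apply/le_anti; rewrite tq_ge0 andbT -(@pmulr_rle0 _ n.+1%:R) ?ltr0n //.
      by move: tq_le; rewrite S0 mulr0 mul0r expr0n -[n == 0]negbK -lt0n n_gt0.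
    have : t ^+ 2 <= 0 by rewrite tq0 mulr0 in CS.
    by rewrite real_exprn_even_le0 ?num_real //= => /eqP->; rewrite ltxx.
  have A_gt0 : 0 < (S / n%:R) ^+ n by rewrite exprn_gt0 // divr_gt0 ?ltr0n.
  have B_gt0 : 0 < (2 * S / n%:R) ^+ n.
    by rewrite exprn_gt0 // divr_gt0 ?mulr_gt0 ?ltr0n.
  have eq1 : n.+1%:R * (d2 * t ^+ 2) = (S / n%:R) ^+ n * (2 * S / n%:R) ^+ n.
    by apply: (mulfI (lt0r_neq0 c_gt0)); rewrite -XE -SnE SX.
  have eq2 : (d2 * tree_sum y) * (n.+1%:R * tree_sum q)
      = (S / n%:R) ^+ n * (2 * S / n%:R) ^+ n.
    by apply/le_anti; rewrite chain2 -eq1.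
  (* The chain of inequalities collapses between two positive numbers, so each
     factor can be cancelled. *)
  have d2_neq0 : d2 != 0.
    apply/eqP => d20; have := mulr_gt0 A_gt0 B_gt0.
    by rewrite -eq1 d20 mul0r mulr0 ltxx.
  have tqE : n.+1%:R * tree_sum q = (2 * S / n%:R) ^+ n.
    apply/le_anti; rewrite tq_le -(ler_pM2l A_gt0) -eq2.
    by apply: ler_wpM2r; rewrite ?mulr_ge0 ?ler0n.
  have [c qE] := tq_eq S_gt0 tqE.
  have tqyE : t ^+ 2 = tree_sum y * tree_sum q.
    have nz1 : n.+1%:R != 0 :> R by rewrite pnatr_eq0.
    by apply: (mulfI nz1); apply: (mulfI d2_neq0); rewrite mulrCA eq1 -eq2; ring.
  have c_pos : 0 < c.
    rewrite ltNge; apply/negP => c_le0; move: S_gt0; rewrite SE ltNge => /negP[].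
    rewrite -oppr_ge0 /edge_sum -sumrN; apply: sumr_ge0 => i _.
    rewrite -sumrN; apply: sumr_ge0 => j ij.
    by rewrite qE ?oppr_ge0 // -(inj_eq val_inj) /= ltn_eqF.
  have r_gt0 i j : i != j -> 0 < r i j.
    by move=> ij; rewrite -(pmulr_lgt0 _ (l_gt0 i j ij)) -/(q i j) qE.
  have [c' lE] : exists c', forall i j, i != j -> l i j = c'.
    by apply: tree_prod_const => // f g; apply: (@tree_sum_CauchySchwarz_eq _ _ r).
  have c'_neq0 : c' != 0.
    have ij : ord0 != lift ord0 (Ordinal n_gt0) by apply: neq_lift.
    by rewrite -(lE _ _ ij) gt_eqF // l_gt0.
  split; first by move=> i j i' j' ij ij'; rewrite -!/(l _ _) !lE.
  have rhoE e : e \in edges n -> rho e = c / c'.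
    rewrite inE => /cards2P[i [j [ij ->]]].
    by rewrite -(qE _ _ ij) /q (lE _ _ ij) mulfK.
  by move=> e f /rhoE-> /rhoE->.
- pose a0 := lift ord0 (Ordinal n_gt0).
  have a0P : ord0 != a0 by apply: neq_lift.
  have lE i j : i != j -> l i j = l ord0 a0 by move=> ij; apply: vreg.
  have rE i j : i != j -> r i j = r ord0 a0.
    by move=> ij; apply: rconst; apply: edge_set.
  set m := l ord0 a0 in lE; set p := r ord0 a0 in rE.
  have tE := tree_sum_const rE; rewrite -/t in tE.
  have d2E : d2 = _ := regular_edge_absdet lE.
  (* The total weight is read off the trace of a scalar matrix. *)
  have S2 : 2 * S = n.+1%:R * n%:R * (p * m).
    have qE i j : i != j -> q i j = p * m by move=> ij; rewrite /q rE ?lE.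
    rewrite SE -tr_laplacian_gram // (laplacian_const_gram qE) mxtrace_scalar.
    by rewrite -mulr_natr; ring.
  apply/eqP; rewrite -(eqrXn2 n2) // XE d2E.
  rewrite (_ : n.+1%:R * _ = (m ^+ 2 / 2) ^+ n * (t * n.+1%:R) ^+ 2); last by ring.
  rewrite tE [(_ ^+ n) ^+ 2]exprAC -!exprMn exprM; apply/eqP; congr (_ ^+ n).
  have -> : S = 2 * S / 2 by field.
  by rewrite S2; field.
Qed.
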